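(* For real $x>1$ let $f_x$ be the totally multiplicative function on positive integers with $f_x(p)=\rho\!\left(\frac{\log p}{\log x}\right)$ for every prime $p$. Then for every $u>0$, $$\Pi(u)=\lim_{x\to\infty}\frac1{x^u}\sum_{n\le x^u}f_x(n).$$
   Context: $\rho$ is the Dickman function: the unique continuous function on $[0,\infty)$ with $\rho=1$ on $[0,1]$ and $u\rho'(u)+\rho(u-1)=0$ for $u>1$. $\Pi:(0,\infty)\to[0,1]$ is the function with $\Pi(u)=1$ for $u\in(0,1]$ and $\Pi(u)=\frac1u\int_0^u\Pi(t)\rho(u-t)\,dt$ for $u>1$ (with $\Pi(0)=1$). *)

(* Defs.v *)
From Stdlib Require Import Reals.
From Coquelicot Require Import Coquelicot.
From mathcomp Require Import ssreflect ssrfun ssrbool ssrnat seq prime.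

Open Scope R_scope.

Definition f_x (rho : R -> R) (x : R) (n : nat) : R :=
  foldr (fun pe acc => (rho (ln (INR pe.1) / ln x)) ^ pe.2 * acc) 1 (prime_decomp n).

Definition sum_upto (g : nat -> R) (y : R) : R :=
  foldr (fun n acc => g n + acc) 0 (iota 1 (Z.to_nat (Int_part y))).

(* Main.v *)
Require Import Defs.
From Stdlib Require Import ZArith Reals Lra Lia.
From HB Require Import structures.
From mathcomp Require Import ssreflect ssrfun ssrbool eqtype ssrnat seq div prime.
From mathcomp Require Import fintype bigop binomial.
From Coquelicot Require Import Coquelicot.
Open Scope R_scope.

(** Taking logarithms, [f n * ln n] is a sum over the primes dividing [n]; hence with
    [S u = x^-u * sum_(n <= x^u) f_x n], [L = ln x] and [t_p = ln p / L],
    [u * S u = sum_(p <= x^u) (ln p / (p L)) * rho t_p * S (u - t_p) + O(1/L)].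
    By Mertens' theorem [sum_(p <= y) ln p / p = ln y + O(1)] the masses [ln p / (p L)]
    at the points [t_p] approximate Lebesgue measure within [O(1/L)], so the Lipschitz
    function [Pi] satisfies the same recursion up to a small error. The difference
    [E = S - Pi] is [O(x^-t)] on [0, 1], where [f_x n = 1], and the recursion is a
    contraction in the norm [sup |E t| exp(- kappa t)], so [E] is small on any [0, U].
    No regularity of [S] is needed, and Chebyshev's and Mertens' elementary bounds
    replace the prime number theorem. *)

(** * Finite sums and products of reals as big operators *)

HB.instance Definition _ := Monoid.isComLaw.Build R 0 Rplus
  (fun x y z => esym (Rplus_assoc x y z)) Rplus_comm Rplus_0_l.
HB.instance Definition _ := Monoid.isComLaw.Build R 1 Rmult
  (fun x y z => esym (Rmult_assoc x y z)) Rmult_comm Rmult_1_l.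
HB.instance Definition _ := Monoid.isMulLaw.Build R 0 Rmult Rmult_0_l Rmult_0_r.
HB.instance Definition _ := Monoid.isAddLaw.Build R Rmult Rplus
  Rmult_plus_distr_r Rmult_plus_distr_l.

Notation "\sum_ ( m <= i < n | P ) F" :=
  (\big[Rplus/0]_(m <= i < n | P%B) F%R) : R_scope.
Notation "\sum_ ( m <= i < n ) F" :=
  (\big[Rplus/0]_(m <= i < n) F%R) : R_scope.

Lemma le_INRb (m n : nat) : (m <= n)%N -> INR m <= INR n.
Proof. by move=> /leP; apply: le_INR. Qed.

Lemma ler_sumR (a b : nat) (P : pred nat) (F G : nat -> R) :
  (forall i, (a <= i < b)%N -> P i -> F i <= G i) ->
  \sum_(a <= i < b | P i) F i <= \sum_(a <= i < b | P i) G i.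
Proof.
move=> H; rewrite big_nat_cond [X in _ <= X]big_nat_cond.
apply: (big_ind2 (fun x y => x <= y)) => [|x1 x2 y1 y2|i /andP[]]; [lra|lra|exact: H].
Qed.

Lemma sum_ge0 (a b : nat) (P : pred nat) (F : nat -> R) :
  (forall i, (a <= i < b)%N -> P i -> 0 <= F i) -> 0 <= \sum_(a <= i < b | P i) F i.
Proof.
move=> H; rewrite big_nat_cond.
apply: (big_ind (fun x => 0 <= x)) => [|x y|i /andP[]]; [lra|lra|exact: H].
Qed.

Lemma sum_abs (a b : nat) (P : pred nat) (F : nat -> R) :
  Rabs (\sum_(a <= i < b | P i) F i) <= \sum_(a <= i < b | P i) Rabs (F i).
Proof.
apply: (big_ind2 (fun x y => Rabs x <= y)) => [|x1 x2 y1 y2 H1 H2|i _].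
- by rewrite Rabs_R0; lra.
- by have := Rabs_triang x1 y1; lra.
- lra.
Qed.

Lemma eq_sumR (a b : nat) (P : pred nat) (F G : nat -> R) :
  (forall i, (a <= i < b)%N -> P i -> F i = G i) ->
  \sum_(a <= i < b | P i) F i = \sum_(a <= i < b | P i) G i.
Proof.
move=> H; rewrite big_nat_cond [RHS]big_nat_cond.
by apply: eq_bigr => i /andP[]; exact: H.
Qed.

Lemma sumD (a b : nat) (P : pred nat) (F G : nat -> R) :
  \sum_(a <= i < b | P i) (F i + G i) =
  \sum_(a <= i < b | P i) F i + \sum_(a <= i < b | P i) G i.
Proof. exact: big_split. Qed.

Lemma sumZ (a b : nat) (P : pred nat) (c : R) (F : nat -> R) :
  \sum_(a <= i < b | P i) (c * F i) = c * \sum_(a <= i < b | P i) F i.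
Proof. by rewrite big_distrr. Qed.

Lemma sumB (a b : nat) (P : pred nat) (F G : nat -> R) :
  \sum_(a <= i < b | P i) (F i - G i) =
  \sum_(a <= i < b | P i) F i - \sum_(a <= i < b | P i) G i.
Proof.
have -> : forall x y, x - y = x + (-1) * y by move=> x y; ring.
by rewrite -sumZ -sumD; apply: eq_bigr => i _; ring.
Qed.

Lemma sum1_INR (K : nat) : \sum_(1 <= n < K.+1) 1 = INR K.
Proof.
elim: K => [|K IH]; first by rewrite big_nil.
by rewrite big_nat_recr //= IH; case: K {IH} => [|K] /=; ring.
Qed.

(** * Prime valuations and logarithms *)

Lemma INR_prime_ge2 (p : nat) : prime p -> 2 <= INR p.
Proof. by move=> /prime_gt1 /le_INRb /=. Qed.

Lemma INR_gt0 (n : nat) : (0 < n)%N -> 1 <= INR n.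
Proof. by move=> /le_INRb. Qed.

Lemma ln_INR_ge0 (n : nat) : (0 < n)%N -> 0 <= ln (INR n).
Proof. by move=> /INR_gt0 h; rewrite -ln_1; apply: ln_le; lra. Qed.

Lemma sum_pred1 (K p : nat) (F : nat -> R) : prime p -> (p < K.+1)%N ->
  \sum_(1 <= q < K.+1 | prime q) (if q == p then F q else 0) = F p.
Proof.
move=> pp pK; rewrite big_mkcond (bigD1_seq p) ?iota_uniq //=; last first.
  by rewrite mem_index_iota pK prime_gt0.
rewrite pp eqxx big1 ?Rplus_0_r // => i /negbTE ->; exact: if_same.
Qed.

Lemma lognM_prime (p q m : nat) : prime p -> (0 < m)%N ->
  logn q (p * m) = ((q == p) + logn q m)%N.
Proof. by move=> pp m0; rewrite (lognM q (prime_gt0 pp) m0) (logn_prime q pp). Qed.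

(** Strong induction, splitting off the smallest prime factor of [n]. The range runs to a common
    bound [K] so that sums over [n] and [p] can later be exchanged. *)
Lemma ln_logn (K n : nat) : (0 < n)%N -> (n <= K)%N ->
  ln (INR n) = \sum_(1 <= p < K.+1 | prime p) (INR (logn p n) * ln (INR p)).
Proof.
elim/ltn_ind: n => n IH n0 nK; case: (ltnP 1 n) => n1; last first.
  have -> : n = 1%N by apply/eqP; rewrite eqn_leq n1 n0.
  rewrite ln_1 big1 // => p _; rewrite logn1 /=; ring.
have pp := pdiv_prime n1; have /dvdnP[m nm] := pdiv_dvd n.
rewrite mulnC in nm; set p := pdiv n in pp nm *.
have m0 : (0 < m)%N by move: n0; rewrite nm muln_gt0 => /andP[].
have mn : (m < n)%N by rewrite nm ltn_Pmull ?prime_gt1.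
have pK : (p < K.+1)%N by rewrite ltnS (leq_trans _ nK) // nm leq_pmulr.
have [p1 m1] := (INR_gt0 p (prime_gt0 pp), INR_gt0 m m0).
rewrite {1}nm mult_INR ln_mult; [|lra|lra].
rewrite (IH m mn m0 (ltnW (leq_trans mn nK))).
rewrite -(sum_pred1 K p (fun q => ln (INR q)) pp pK) -sumD.
apply: eq_sumR => q _ pq; rewrite nm lognM_prime // plus_INR.
by case: (q == p) => /=; ring.
Qed.

Lemma sum_multiples (p K : nat) (a : nat -> R) : (0 < p)%N ->
  \sum_(1 <= n < K.+1 | p %| n) a n = \sum_(1 <= m < (K %/ p).+1) a (p * m)%N.
Proof.
move=> p0; elim: K => [|K IH]; first by rewrite div0n !big_nil.
rewrite big_mkcond big_nat_recr //= -big_mkcond /= IH divnS //.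
case: (boolP (p %| K.+1)) => h; rewrite ?add0n ?Rplus_0_r //.
rewrite add1n [RHS]big_nat_recr //=; congr (_ + a _).
by rewrite -[(K %/ p).+1]add1n -(divnK h) divnS // h mulnC.
Qed.

(** For [f] constantly 1 and [p] prime this is the exponent of [p] in the factorial of [K]. *)
Definition val_sum (p : nat) (f : nat -> R) (K : nat) : R :=
  \sum_(1 <= n < K.+1) (INR (logn p n) * f n).

(** Only multiples n = pm contribute, and there the valuation is one more than that of m. Iterating
    would give the sum over powers of [p]; the recursive form avoids handling those powers
    explicitly. *)
Lemma val_sum_rec (c f : nat -> R) (p K : nat) :
  (forall q m, prime q -> (0 < m)%N -> f (q * m)%N = c q * f m) -> prime p ->
  val_sum p f K = c p * (\sum_(1 <= n < (K %/ p).+1) f n + val_sum p f (K %/ p)).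
Proof.
move=> fM pp; rewrite /val_sum -sumD -sumZ.
rewrite (eq_big_nat _ _ (F2 := fun n => if (p %| n)%N then INR (logn p n) * f n else 0)).
  rewrite -big_mkcond /= sum_multiples ?prime_gt0 //.
  apply: eq_sumR => m /andP[m0 _] _; rewrite fM // lognM_prime // eqxx plus_INR /=; ring.
move=> n /andP[n0 _]; case: ifP => // /negbT h.
by rewrite lognE pp n0 (negbTE h) /=; ring.
Qed.

(** Expand [ln (INR n)] over primes by [ln_logn] and exchange the two sums. *)
Lemma weighted_log_sum (f : nat -> R) (K : nat) :
  \sum_(1 <= n < K.+1) (f n * ln (INR n)) =
  \sum_(1 <= p < K.+1 | prime p) (ln (INR p) * val_sum p f K).
Proof.
rewrite (eq_big_nat _ _ (F2 := fun n => \sum_(1 <= p < K.+1 | prime p)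
   (ln (INR p) * (INR (logn p n) * f n)))).
  rewrite exchange_big_nat; apply: eq_bigr => p _; exact: sumZ.
move=> n /andP[n0 nK]; rewrite (ln_logn K) // -sumZ.
apply: eq_sumR => p _ _; ring.
Qed.

Lemma val_sum1_ge (p K : nat) : prime p -> INR (K %/ p) <= val_sum p (fun=> 1) K.
Proof.
move=> pp; rewrite (val_sum_rec (fun=> 1)) ?sum1_INR; [|move=> *; ring|done].
suff : 0 <= val_sum p (fun=> 1) (K %/ p) by lra.
apply: sum_ge0 => n _ _; have := pos_INR (logn p n); lra.
Qed.

Lemma INR_divn_le (K p : nat) : (0 < p)%N -> INR (K %/ p) * INR p <= INR K.
Proof. by move=> p0; rewrite -mult_INR; apply: le_INRb; rewrite leq_trunc_div. Qed.

(** Replaces the geometric series in Legendre's formula: with q = [K %/ p], the recursion and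
    induction give at most (p - 1)q + q = pq, which is at most [K]. *)
Lemma val_sum1_le (p K : nat) : prime p ->
  (INR p - 1) * val_sum p (fun=> 1) K <= INR K.
Proof.
move=> pp; have p2 := INR_prime_ge2 p pp.
elim/ltn_ind: K => K IH; case: (posnP K) => [->|K0].
  by rewrite /val_sum big_nil /=; lra.
rewrite (val_sum_rec (fun=> 1)) ?sum1_INR; [|move=> *; ring|done].
have h := IH _ (ltn_Pdiv (prime_gt1 pp) K0).
have := INR_divn_le K p (prime_gt0 pp); nra.
Qed.

Lemma val_sum_abs_le (f : nat -> R) (p K : nat) :
  (forall n, (0 < n)%N -> Rabs (f n) <= 1) ->
  Rabs (val_sum p f K) <= val_sum p (fun=> 1) K.
Proof.
move=> f1; apply: Rle_trans (sum_abs _ _ _ _) _.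
apply: ler_sumR => n /andP[n0 _] _; rewrite Rabs_mult (Rabs_pos_eq (INR _)); last exact: pos_INR.
by apply: Rmult_le_compat_l; [exact: pos_INR|exact: f1].
Qed.

(** * Chebyshev and Mertens estimates *)

Arguments INR : simpl never.

Lemma ln_le_sub1 (y : R) : 0 < y -> ln y <= y - 1.
Proof. by move=> y0; have := exp_ineq1_le (ln y); rewrite exp_ln //; lra. Qed.

Lemma ln_sub_le (a b : R) : 0 < a -> 0 < b -> ln b - ln a <= (b - a) / a.
Proof.
move=> a0 b0; rewrite -ln_div //.
have h : 0 < b / a by exact: Rdiv_lt_0_compat.
apply: Rle_trans (ln_le_sub1 _ h) _; right; field; lra.
Qed.

Definition theta (K : nat) : R := \sum_(1 <= p < K.+1 | prime p) ln (INR p).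

(** The prime divides (2m)!, which is the binomial coefficient times m! twice, and it cannot divide
    m! because m < p. *)
Lemma dvdn_bin_central (m p : nat) : prime p -> (m < p)%N -> (p <= m + m)%N ->
  (p %| 'C(m + m, m))%N.
Proof.
move=> pp mp p2m.
have : (p %| (m + m)`!)%N by apply: dvdn_fact; rewrite prime_gt0.
rewrite -(bin_fact (leq_addl m m)) addnK !Euclid_dvdM // orbb => /orP[//|].
suff h : forall k, (k < p)%N -> (p %| k`!)%N = false by rewrite h.
elim=> [|k IH] kp; first by rewrite fact0 dvdn1 gtn_eqF // prime_gt1.
by rewrite factS Euclid_dvdM // IH ?(ltnW kp) // orbF gtnNdvd.
Qed.

Lemma bin_le_exp2 (n m : nat) : (m <= n)%N -> ('C(n, m) <= 2 ^ n)%N.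
Proof.
move=> mn; rewrite -[2%N]/(1 + 1)%N expnDn.
rewrite (bigD1 (Ordinal (mn : (m < n.+1)%N))) //= !exp1n !muln1.
exact: leq_addr.
Qed.

Lemma INR_expn (a n : nat) : INR (a ^ n)%N = INR a ^ n.
Proof. by elim: n => [|n IH] //=; rewrite expnS mult_INR IH. Qed.

(** Chebyshev's argument: every prime in (m, 2m] divides the central binomial coefficient, whose
    logarithm is at most 2m ln 2. *)
Lemma theta_double (m : nat) : theta (m + m) - theta m <= 2 * INR m.
Proof.
have C0 : (0 < 'C(m + m, m))%N by rewrite bin_gt0 leq_addl.
set B := 'C(m + m, m) in C0 *.
have lB : ln (INR B) <= 2 * INR m.
  have h := le_INRb _ _ (bin_le_exp2 _ _ (leq_addl m m)).
  rewrite INR_expn -/B -[INR 2]/2 in h.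
  apply: Rle_trans (ln_le _ _ _ h) _; first by have := INR_gt0 _ C0; lra.
  rewrite ln_pow /=; last lra.
  rewrite plus_INR; have := ln_le_sub1 2; have := pos_INR m.
  nra.
(* The range up to [B + (m + m)] covers both the prime factors of [B] and the interval (m, 2m]. *)
apply: Rle_trans lB; rewrite (ln_logn (B + (m + m)) B C0 (leq_addr _ _)).
rewrite /theta (big_cat_nat (n := m.+1)) ?ltnS ?leq_addr //=.
have -> : forall x y, x + y - x = y by move=> x y; ring.
apply: Rle_trans (_ : \sum_(m.+1 <= p < (m + m).+1 | prime p)
   (INR (logn p B) * ln (INR p)) <= _).
  apply: ler_sumR => p /andP[mp p2m] pp.
  have : (0 < logn p B)%N by rewrite logn_gt0 mem_primes pp C0 dvdn_bin_central.
  move=> /INR_gt0; have := ln_INR_ge0 p (prime_gt0 pp); nra.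
have pos a b : 0 <= \sum_(a <= p < b | prime p) (INR (logn p B) * ln (INR p)).
  apply: sum_ge0 => p _ pp; apply: Rmult_le_pos; first exact: pos_INR.
  by apply: ln_INR_ge0; rewrite prime_gt0.
have h2 : ((m + m).+1 <= (B + (m + m)).+1)%N by rewrite ltnS leq_addl.
have h1 : (m.+1 <= (m + m).+1)%N by rewrite ltnS leq_addr.
rewrite [X in _ <= X](big_cat_nat (isT : (1 <= m.+1)%N) (leq_trans h1 h2)) /=.
rewrite [X in _ <= _ + X](big_cat_nat h1 h2) /=.
have := pos 1%N m.+1; have := pos (m + m).+1 (B + (m + m)).+1; lra.
Qed.

(** Halve: with m = [K./2], induction and doubling give 6m for theta(2m). When [K] is odd, the one
    extra term is at most ln(2m + 1) <= 2m, which still fits under 8m. *)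
Lemma theta_le (K : nat) : theta K <= 4 * INR K.
Proof.
elim/ltn_ind: K => K IH; case: (leqP K 1) => K1.
  rewrite /theta big1_seq; first by have := pos_INR K; lra.
  move=> p /andP[/prime_gt1 p1]; rewrite mem_index_iota => /andP[_].
  by rewrite ltnS => /leq_trans /(_ K1); rewrite leqNgt p1.
have K2 : (K./2 < K)%N by rewrite -divn2 ltn_Pdiv // ltnW.
have h := IH _ K2; have d := theta_double K./2; have m0 := pos_INR K./2.
rewrite -(odd_double_half K) -addnn; case: (odd K); last first.
  rewrite add0n plus_INR; lra.
rewrite add1n S_INR plus_INR /theta big_mkcond big_nat_recr // -big_mkcond -/(theta _).
have := ln_le_sub1 (INR (K./2 + K./2).+1); rewrite S_INR plus_INR => l.
case: ifP => _; rewrite /= ?S_INR ?plus_INR; lra.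
Qed.

Lemma sum_ln_upper (K : nat) :
  \sum_(1 <= n < K.+1) ln (INR n) <= INR K * ln (INR K).
Proof.
rewrite -[X in X * _]sum1_INR Rmult_comm -sumZ.
apply: ler_sumR => n /andP[n0 nK] _; rewrite Rmult_1_r; apply: ln_le.
  by have := INR_gt0 n n0; lra.
by apply: le_INRb; rewrite -ltnS.
Qed.

(** A weak Stirling bound. The induction step amounts to k (ln(k + 1) - ln k) <= 1. *)
Lemma sum_ln_lower (K : nat) : (0 < K)%N ->
  INR K * ln (INR K) - INR K <= \sum_(1 <= n < K.+1) ln (INR n).
Proof.
elim: K => // -[_ _|K IH _]; first by rewrite big_nat1 INR_1 ln_1; lra.
rewrite big_nat_recr //=; have {}IH := IH isT.
rewrite (S_INR K.+1); set k := INR K.+1 in IH *.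
have k1 : 1 <= k by exact: INR_gt0.
have := ln_sub_le k (k + 1).
have -> : (k + 1 - k) / k = / k by field; lra.
move=> h; have {}h : k * (ln (k + 1) - ln k) <= 1.
  rewrite -[X in _ <= X](Rinv_r k); [apply: Rmult_le_compat_l; [lra|apply: h; lra]|lra].
lra.
Qed.

(* Telescoping against (ln n + 2) / n. *)
Lemma sum_prime_ln_le2 (K : nat) :
  \sum_(1 <= p < K.+1 | prime p) (ln (INR p) / (INR p * (INR p - 1))) <= 2.
Proof.
(* The shift by 2 makes both sides vanish at [K = 1]. *)
suff : forall K, (0 < K)%N -> \sum_(1 <= p < K.+1 | prime p) (ln (INR p) / (INR p * (INR p - 1)))
   <= 2 - (ln (INR K) + 2) / INR K.
  move=> h; case: (posnP K) => [->|K0]; first by rewrite big_nil; lra.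
  apply: Rle_trans (h K K0) _.
  suff : 0 <= (ln (INR K) + 2) / INR K by lra.
  apply: Rdiv_le_0_compat; [have := ln_INR_ge0 K K0|have := INR_gt0 K K0]; lra.
elim=> // -[_ _|{}K IH _]; first by rewrite big_mkcond big_nat1 /= INR_1 ln_1; lra.
rewrite big_mkcond big_nat_recr // -big_mkcond.
apply: Rle_trans (Rplus_le_compat_r _ _ _ (IH isT)) _.
have k1 : 1 <= INR K.+1 by exact: INR_gt0.
rewrite (S_INR K.+1); set k := INR K.+1 in k1 *.
have l1 : 0 <= ln (k + 1) by rewrite -ln_1; apply: ln_le; lra.
have key : ln (k + 1) / ((k + 1) * (k + 1 - 1)) <= (ln k + 2) / k - (ln (k + 1) + 2) / (k + 1).
  have := ln_sub_le k (k + 1).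
  have -> : (k + 1 - k) / k = / k by field; lra.
  move=> h; have {}h : k * (ln (k + 1) - ln k) <= 1.
    rewrite -[X in _ <= X](Rinv_r k); [apply: Rmult_le_compat_l; [lra|apply: h; lra]|lra].
  (* The numerator equals ln k + 2 - k (ln(k + 1) - ln k), hence is at least ln k + 1, and so at
     least ln(k + 1). *)
  have -> : (ln k + 2) / k - (ln (k + 1) + 2) / (k + 1) =
     ((k + 1) * (ln k + 2) - k * (ln (k + 1) + 2)) / ((k + 1) * (k + 1 - 1)) by field; lra.
  apply: Rmult_le_compat_r; first by left; apply: Rinv_0_lt_compat; nra.
  have d : ln (k + 1) - ln k <= 1 by nra.
  nra.
case: ifP => _; first lra.
suff : 0 <= ln (k + 1) / ((k + 1) * (k + 1 - 1)) by lra.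
apply: Rdiv_le_0_compat; nra.
Qed.

Definition mertens_sum (K : nat) : R := \sum_(1 <= p < K.+1 | prime p) (ln (INR p) / INR p).

Lemma INR_divn_gt (K p : nat) : (0 < p)%N -> INR K < (INR (K %/ p) + 1) * INR p.
Proof.
by move=> p0; rewrite -S_INR -mult_INR; apply/lt_INR/ltP/ltn_ceil.
Qed.

(** The logarithm of K! is evaluated twice: it lies between K ln K - K and K ln K, and it is the sum
    of ln p times the exponent of p. That exponent exceeds K/p - 1, which costs [theta K] <= 4K, and
    is at most K/(p - 1), which costs at most 2K. *)
Lemma mertens (K : nat) : (0 < K)%N -> Rabs (mertens_sum K - ln (INR K)) <= 4.
Proof.
move=> K0; have K1 := INR_gt0 K K0.
have T : \sum_(1 <= n < K.+1) ln (INR n) =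
    \sum_(1 <= p < K.+1 | prime p) (ln (INR p) * val_sum p (fun=> 1) K).
  rewrite -weighted_log_sum; apply: eq_bigr => n _; ring.
have U := sum_ln_upper K; have L := sum_ln_lower K K0; rewrite T in U L.
have A : INR K * mertens_sum K - theta K <=
    \sum_(1 <= p < K.+1 | prime p) (ln (INR p) * val_sum p (fun=> 1) K).
  rewrite /mertens_sum /theta -sumZ -sumB; apply: ler_sumR => p _ pp.
  have p2 := INR_prime_ge2 p pp; have l0 := ln_INR_ge0 p (prime_gt0 pp).
  have v := val_sum1_ge p K pp; have g := INR_divn_gt K p (prime_gt0 pp).
  have -> : INR K * (ln (INR p) / INR p) - ln (INR p) = ln (INR p) * (INR K / INR p - 1) by field; lra.
  apply: Rmult_le_compat_l => //; apply: Rle_trans v.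
  suff : INR K / INR p <= INR (K %/ p) + 1 by lra.
  apply/Rle_div_l; lra.
have B : \sum_(1 <= p < K.+1 | prime p) (ln (INR p) * val_sum p (fun=> 1) K) <=
   INR K * (mertens_sum K + 2).
  apply: Rle_trans (_ : INR K * (mertens_sum K + 
      \sum_(1 <= p < K.+1 | prime p) (ln (INR p) / (INR p * (INR p - 1)))) <= _); last first.
    have := sum_prime_ln_le2 K; nra.
  rewrite /mertens_sum -sumD -sumZ; apply: ler_sumR => p _ pp.
  have p2 := INR_prime_ge2 p pp; have l0 := ln_INR_ge0 p (prime_gt0 pp).
  have v := val_sum1_le p K pp.
  have -> : INR K * (ln (INR p) / INR p + ln (INR p) / (INR p * (INR p - 1))) =
    ln (INR p) * (INR K / (INR p - 1)) by field; lra.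
  apply: Rmult_le_compat_l => //; apply/Rle_div_r; lra.
have th := theta_le K.
apply: Rabs_le; split; nra.
Qed.

(** * Approximate recursion for sums of a multiplicative function *)

(** Write ln N = (ln N - ln n) + ln n. The first part contributes at most [N] by [sum_ln_lower]. In
    the second, [val_sum_rec] produces the main term, and its remainder, coming from higher prime
    powers, is at most 2N by [sum_prime_ln_le2]. *)
Lemma log_mean_recursion (c f : nat -> R) (N : R) (K : nat) :
  (forall q m, prime q -> (0 < m)%N -> f (q * m)%N = c q * f m) ->
  (forall p, prime p -> Rabs (c p) <= 1) ->
  (forall n, (0 < n)%N -> Rabs (f n) <= 1) ->
  (0 < K)%N -> INR K <= N ->
  Rabs (ln N * \sum_(1 <= n < K.+1) f n -
    \sum_(1 <= p < K.+1 | prime p) (ln (INR p) * c p * \sum_(1 <= n < (K %/ p).+1) f n))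
  <= 3 * N.
Proof.
move=> fM c1 f1 K0 KN; have K1 := INR_gt0 K K0.
have -> : ln N * \sum_(1 <= n < K.+1) f n =
   \sum_(1 <= n < K.+1) (f n * (ln N - ln (INR n))) + \sum_(1 <= n < K.+1) (f n * ln (INR n)).
  rewrite -sumD -sumZ; apply: eq_bigr => n _; ring.
have -> : forall a b d, a + b - d = a + (b - d) by move=> *; ring.
apply: Rle_trans (Rabs_triang _ _) _.
have -> : 3 * N = N + 2 * N by ring.
apply: Rplus_le_compat.
  apply: Rle_trans (sum_abs _ _ _ _) _.
  apply: Rle_trans (_ : \sum_(1 <= n < K.+1) (ln N * 1 - ln (INR n)) <= _).
    apply: ler_sumR => n /andP[n0 nK] _; rewrite Rabs_mult Rmult_1_r.
    have n1 := INR_gt0 n n0; have nN : INR n <= N by apply: Rle_trans KN; apply: le_INRb; rewrite -ltnS.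
    rewrite (Rabs_pos_eq (_ - _)); last by have := ln_le (INR n) N; lra.
    have := f1 n n0; have := Rabs_pos (f n); have := ln_le (INR n) N; nra.
  rewrite sumB sumZ sum1_INR; have L := sum_ln_lower K K0.
  have h : INR K * (ln N - ln (INR K)) <= N - INR K.
    have -> : N - INR K = INR K * ((N - INR K) / INR K) by field; lra.
    apply: Rmult_le_compat_l; [lra|apply: ln_sub_le; lra].
  lra.
rewrite weighted_log_sum -sumB.
apply: Rle_trans (sum_abs _ _ _ _) _.
apply: Rle_trans (_ : INR K * \sum_(1 <= p < K.+1 | prime p)
     (ln (INR p) / (INR p * (INR p - 1))) <= _); last first.
  have := sum_prime_ln_le2 K; nra.
rewrite -sumZ; apply: ler_sumR => p _ pp; rewrite (val_sum_rec c) //.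
have p2 := INR_prime_ge2 p pp; have l0 := ln_INR_ge0 p (prime_gt0 pp).
set F := \sum_(1 <= n < (K %/ p).+1) f n.
have -> : forall l k v, l * (k * (F + v)) - l * k * F = l * (k * v) by move=> *; ring.
rewrite !Rabs_mult (Rabs_pos_eq (ln _)) //.
have -> : INR K * (ln (INR p) / (INR p * (INR p - 1))) =
   ln (INR p) * (INR K / INR p / (INR p - 1)) by field; lra.
apply: Rmult_le_compat_l => //.
have a := val_sum_abs_le f p (K %/ p) f1; have b := val_sum1_le p (K %/ p) pp.
have d := INR_divn_le K p (prime_gt0 pp); have cp := c1 p pp.
apply: Rle_trans (_ : val_sum p (fun=> 1) (K %/ p) <= _).
  have := Rabs_pos (c p); have := Rabs_pos (val_sum p f (K %/ p)); nra.
apply: (proj1 (Rle_div_r _ _ _ _)); first lra.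
apply: (proj1 (Rle_div_r _ _ _ _)); first lra.
have := Rmult_le_compat_r (INR p) _ _ ltac:(lra) b; lra.
Qed.

(** * The multiplicative function *)

Lemma foldr_bigop (T : Type) (op : R -> R -> R) (idx : R) (s : seq T) (F : T -> R) :
  foldr (fun i acc => op (F i) acc) idx s = \big[op/idx]_(i <- s) F i.
Proof. by elim: s => [|i s IH]; rewrite ?big_nil // big_cons /= IH. Qed.

(** Primes not dividing [n] enter with exponent 0, so different arguments can share one index range
    and their products be compared factor by factor. *)
Lemma f_x_prod (rho : R -> R) (x : R) (K n : nat) : (0 < n)%N -> (n <= K)%N ->
  f_x rho x n = \big[Rmult/1]_(1 <= p < K.+1 | prime p)
    (rho (ln (INR p) / ln x)) ^ logn p n.
Proof.
move=> n0 nK; rewrite /f_x foldr_bigop prime_decompE big_map /=.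
have : perm_eq (primes n) [seq p <- index_iota 1 K.+1 | p \in primes n].
  apply: uniq_perm; rewrite ?primes_uniq ?filter_uniq ?iota_uniq // => p.
  rewrite mem_filter mem_index_iota; case: (boolP (p \in primes n)) => //= pn.
  move: pn; rewrite mem_primes => /and3P[pp _ /(dvdn_leq n0) pn].
  by rewrite prime_gt0 // ltnS (leq_trans pn nK).
move=> E; rewrite (perm_big _ E) big_filter big_mkcond [RHS]big_mkcond; apply: eq_bigr => p _.
rewrite mem_primes n0 /=; case: (boolP (prime p)) => //= pp.
by case: ifPn => // pn; rewrite lognE pp n0 (negbTE pn).
Qed.

Lemma f_x_mul (rho : R -> R) (x : R) (p m : nat) : prime p -> (0 < m)%N ->
  f_x rho x (p * m)%N = rho (ln (INR p) / ln x) * f_x rho x m.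
Proof.
move=> pp m0; have p0 := prime_gt0 pp.
have pm0 : (0 < p * m)%N by rewrite muln_gt0 p0.
rewrite (f_x_prod _ _ (p * m) _ pm0 (leqnn _)) (f_x_prod _ _ (p * m) _ m0 (leq_pmull _ p0)).
have -> : rho (ln (INR p) / ln x) = \big[Rmult/1]_(1 <= q < (p * m).+1 | prime q)
   (if q == p then rho (ln (INR q) / ln x) else 1).
  rewrite big_mkcond (bigD1_seq p) ?iota_uniq //=; last first.
    by rewrite mem_index_iota p0 ltnS leq_pmulr.
  rewrite pp eqxx big1 ?Rmult_1_r // => i /negbTE ->; exact: if_same.
rewrite -big_split; apply: eq_bigr => q _; rewrite lognM_prime //.
by case: (q == p); rewrite ?add1n ?add0n /=; ring.
Qed.

Lemma f_x_abs_le1 (rho : R -> R) (x : R) (n : nat) :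
  (forall p, prime p -> Rabs (rho (ln (INR p) / ln x)) <= 1) -> (0 < n)%N ->
  Rabs (f_x rho x n) <= 1.
Proof.
move=> H n0; rewrite (f_x_prod _ _ n _ n0 (leqnn _)).
apply: (big_ind (fun y => Rabs y <= 1)) => [|y z Hy Hz|p pp].
- by rewrite Rabs_R1; lra.
- rewrite Rabs_mult; have := Rabs_pos y; have := Rabs_pos z; nra.
- rewrite -RPow_abs; elim: (logn p n) => [|k IH] /=; first lra.
  have := H p pp; have := Rabs_pos (rho (ln (INR p) / ln x)).
  have := pow_le _ k (Rabs_pos (rho (ln (INR p) / ln x))); nra.
Qed.

Lemma f_x_eq1 (rho : R -> R) (x : R) (n : nat) :
  (forall p, prime p -> (p <= n)%N -> rho (ln (INR p) / ln x) = 1) -> (0 < n)%N ->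
  f_x rho x n = 1.
Proof.
move=> H n0; rewrite (f_x_prod _ _ n _ n0 (leqnn _)) big_nat_cond big1 //.
by move=> p /andP[/andP[_ pn] pp]; rewrite H // pow1.
Qed.

Definition floor_nat (y : R) : nat := Z.to_nat (Int_part y).

Lemma sum_uptoE (g : nat -> R) (y : R) :
  sum_upto g y = \sum_(1 <= n < (floor_nat y).+1) g n.
Proof. by rewrite /sum_upto (foldr_bigop _ Rplus) /index_iota subn1. Qed.

Lemma floor_nat_bounds (y : R) : 0 <= y -> INR (floor_nat y) <= y < INR (floor_nat y) + 1.
Proof.
move=> y0; have [h1 h2] := base_Int_part y.
have z0 : (0 <= Int_part y)%Z.
  have : (-1 < Int_part y)%Z by apply: lt_IZR; lra.
  lia.
rewrite /floor_nat INR_IZR_INZ Z2Nat.id //; lra.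
Qed.

Lemma leq_floor_nat (y : R) (n : nat) : 0 <= y -> (n <= floor_nat y)%N <-> INR n <= y.
Proof.
move=> y0; have [h1 h2] := floor_nat_bounds y y0; split=> [/le_INRb|h]; first lra.
rewrite -ltnS; apply/ltP/INR_lt; rewrite S_INR; lra.
Qed.

(** Both sides have the same lower bounds: n lies below either one exactly when np <= y. This turns
    the inner ranges [K %/ p] of the recursion into cutoffs at y/p. *)
Lemma floor_nat_div (y : R) (p : nat) : 0 <= y -> (0 < p)%N ->
  floor_nat (y / INR p) = (floor_nat y %/ p)%N.
Proof.
move=> y0 p0; have p1 := INR_gt0 p p0.
have yp : 0 <= y / INR p by apply: Rdiv_le_0_compat; lra.
have E n : (n <= floor_nat (y / INR p))%N = (n <= floor_nat y %/ p)%N.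
  rewrite leq_divRL //; apply/idP/idP.
    move/(leq_floor_nat _ _ yp) => h; apply/(leq_floor_nat _ _ y0).
    rewrite mult_INR; apply/(Rle_div_r (INR n)) => //; lra.
  move/(leq_floor_nat _ _ y0); rewrite mult_INR => h; apply/(leq_floor_nat _ _ yp).
  apply/(Rle_div_r (INR n)) => //; lra.
by apply/eqP; rewrite eqn_leq -E leqnn E leqnn.
Qed.

(** * The Dickman function and the limit function *)

(** [Rmax 0] is 1-Lipschitz with values in the half-line, so freezing [g] at its value at 0 on the
    left gives two-sided continuity. *)
Lemma continuous_extend_right (g : R -> R) :
  (forall u, 0 <= u ->
     filterlim g (within (fun t => 0 <= t) (locally u)) (locally (g u))) ->
  forall t, continuous (fun t => g (Rmax 0 t)) t.
Proof.
move=> H t; apply: (filterlim_comp _ _ _ (Rmax 0) g); last exact: H (Rmax_l 0 t).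
move=> P [eps He]; exists eps => z Hz; apply: He; last exact: Rmax_l.
move: Hz; rewrite /ball /= /AbsRing_ball /abs /minus /plus /opp /=.
apply: Rle_lt_trans; rewrite /Rmax; repeat case: Rle_dec => ?; unfold Rabs; repeat case: Rcase_abs => ?; lra.
Qed.

(** The delay equation integrates to: u rho(u) is the integral of rho over [u - 1, u]. If |rho| is
    maximal on [0, u] at m > 1, then m |rho(m)| <= |rho(m)|, which forces rho(m) = 0. *)
Lemma dickman_bounded (rho : R -> R) :
  (forall u, 0 <= u ->
     filterlim rho (within (fun t => 0 <= t) (locally u)) (locally (rho u))) ->
  (forall u, 0 <= u <= 1 -> rho u = 1) ->
  (forall u, 1 < u -> ex_derive rho u /\ u * Derive rho u + rho (u - 1) = 0) ->
  forall u, 0 <= u -> Rabs (rho u) <= 1.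
Proof.
move=> Hc H1 Hd; pose r t := rho (Rmax 0 t).
have rc : forall t, continuous r t by exact: continuous_extend_right.
have rE : forall t, 0 <= t -> r t = rho t by move=> t t0; rewrite /r Rmax_right.
have rI : forall a b, ex_RInt r a b by move=> a b; apply: ex_RInt_continuous => *; exact: rc.
pose I u := RInt r 0 u.
have dI u : is_derive I u (r u).
  apply: (is_derive_RInt r I 0); last exact: rc.
  by apply: filter_forall => z; apply: RInt_correct.
have avg u : 1 <= u -> u * r u = RInt r (u - 1) u.
  move=> u1; have -> : RInt r (u - 1) u = I u - I (u - 1).
    have h : RInt r 0 (u - 1) + RInt r (u - 1) u = RInt r 0 u by exact: RInt_Chasles.
    rewrite /I; lra.
  (* The delay equation says that [g] has zero derivative beyond 1, and [g 1 = 0] because [r] is 1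
     on [0, 1]. *)
  pose g v := v * r v - (I v - I (v - 1)).
  have dg v : 1 < v -> is_derive g v 0.
    move=> v1; have [ed e] := Hd v v1.
    have dr : is_derive r v (Derive rho v).
      apply: (is_derive_ext_loc rho); last exact: Derive_correct.
      have v0 : 0 < v by lra.
      exists (mkposreal v v0) => z; rewrite /ball /= /AbsRing_ball /abs /minus /plus /opp /= => hz.
      rewrite rE //; move: hz; unfold Rabs; case: Rcase_abs => ?; lra.
    rewrite -(rE (v - 1)) in e; last lra.
    have rv := rE v ltac:(lra).
    have dI1 := dI (v - 1); have dIv := dI v.
    have -> : 0 = (1 * r v + v * Derive rho v) - (r v - 1 * r (v - 1)) by lra.
    apply: (is_derive_minus (fun v => v * r v) (fun v => I v - I (v - 1))).
      apply: (is_derive_mult (fun v => v) r) => //; first exact: is_derive_id.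
      by move=> *; apply: Rmult_comm.
    apply: (is_derive_minus I (fun v => I (v - 1))) => //.
    apply: (is_derive_comp I (fun v => v - 1)) => //.
    by auto_derive; [|ring].
  have cg v : continuity_pt g v.
    apply/continuity_pt_filterlim.
    apply: (continuous_minus (fun v => v * r v) (fun v => I v - I (v - 1))).
      apply: (continuous_mult (fun v => v) r) => //; exact: continuous_id.
    apply: (continuous_minus I (fun v => I (v - 1))).
      by apply: (ex_derive_continuous I); exists (r v).
    apply: (continuous_comp (fun v => v - 1) I).
      by apply: (ex_derive_continuous (fun v => v - 1)); auto_derive.
    by apply: (ex_derive_continuous I); exists (r (v - 1)).
  have [||c [_ E]] := MVT_gen g 1 u (fun=> 0).
  - by move=> v; rewrite Rmin_left // => -[h _]; exact: dg.
  - by move=> *; exact: cg.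
  have g1 : g 1 = 0.
    rewrite /g /I Rminus_diag RInt_point rE; last lra.
    rewrite H1; last lra.
    rewrite (RInt_ext r (fun=> 1)); first by rewrite RInt_const /scal /= /mult /= /zero /=; ring.
    move=> t; rewrite Rmin_left ?Rmax_right; [|lra|lra] => ht.
    by rewrite rE ?H1; lra.
  move: E; rewrite g1 /g; lra.
move=> u u0.
have ca c : 0 <= c <= u -> continuity_pt (fun t => Rabs (r t)) c.
  move=> _; apply/continuity_pt_filterlim; apply: (continuous_comp r Rabs) => //.
  exact: continuous_Rabs.
have [m [Hm [m0 mu]]] := continuity_ab_maj _ 0 u u0 ca.
apply: Rle_trans (_ : Rabs (r m) <= _); first by rewrite -rE //; apply: Hm; lra.
case: (Rle_dec m 1) => m1; first by rewrite rE // H1 ?Rabs_R1; lra.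
have := avg m ltac:(lra).
have h : Rabs (RInt r (m - 1) m) <= (m - (m - 1)) * Rabs (r m).
  by apply: abs_RInt_le_const => // [|t ht]; [lra|apply: Hm; lra].
move=> e; rewrite -e Rabs_mult Rabs_pos_eq // in h.
have := Rabs_pos (r m); nra.
Qed.

(** Beyond 1 the derivative is -rho(u - 1)/u, of absolute value at most 1; an interval that starts
    before 1 reduces to one starting at 1. *)
Lemma dickman_lipschitz (rho : R -> R) :
  (forall u, 0 <= u ->
     filterlim rho (within (fun t => 0 <= t) (locally u)) (locally (rho u))) ->
  (forall u, 0 <= u <= 1 -> rho u = 1) ->
  (forall u, 1 < u -> ex_derive rho u /\ u * Derive rho u + rho (u - 1) = 0) ->
  forall a b, 0 <= a <= b -> Rabs (rho b - rho a) <= b - a.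
Proof.
move=> Hc H1 Hd; have B := dickman_bounded _ Hc H1 Hd.
have main a b : 1 <= a <= b -> Rabs (rho b - rho a) <= b - a.
  move=> [a1 ab].
  have [||c] := MVT_gen rho a b (fun u => - rho (u - 1) / u).
  - move=> v; rewrite Rmin_left // => -[h _]; have [ed e] := Hd v ltac:(lra).
    have -> : - rho (v - 1) / v = Derive rho v.
      apply: (Rmult_eq_reg_l v); last lra.
      have -> : v * (- rho (v - 1) / v) = - rho (v - 1) by field; lra.
      lra.
    exact: Derive_correct.
  - move=> v; rewrite Rmin_left // => -[h _].
    apply/continuity_pt_filterlim => P HP.
    have [e He] := Hc v ltac:(lra) P HP.
    (* A radius of at most [v] keeps the ball in the half-line, where the one-sided continuity
       applies. *)
    have v1 : 0 < Rmin e v by apply: Rmin_pos; [exact: cond_pos|lra].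
    exists (mkposreal _ v1) => z /= hz.
    have hz' : Rabs (z - v) < Rmin e v by exact: hz.
    apply: He.
      by apply: Rlt_le_trans hz' _; exact: Rmin_l.
    have := Rmin_r e v; move: hz'; unfold Rabs; case: Rcase_abs => ?; lra.
  rewrite Rmin_left // => -[[c1 _] ->].
  rewrite Rabs_mult (Rabs_pos_eq (b - a)); last lra.
  suff : Rabs (- rho (c - 1) / c) <= 1 by nra.
  rewrite Rabs_div ?Rabs_Ropp ?(Rabs_pos_eq c); try lra.
  apply/Rle_div_l; first lra.
  have := B (c - 1); lra.
move=> a b [a0 ab]; case: (Rle_dec b 1) => b1.
  by rewrite !H1 ?Rminus_diag ?Rabs_R0; lra.
case: (Rle_dec 1 a) => a1; first by apply: main; lra.
have := main 1 b ltac:(lra); rewrite (H1 1) ?(H1 a); lra.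
Qed.

(** For [u <= 1] the integrand is 1, so the integral equation extends down to 0 and later arguments
    need no case split. *)
Lemma convolution_is_RInt (rho Pi : R -> R) :
  (forall u, 0 <= u <= 1 -> rho u = 1) -> (forall u, 0 <= u <= 1 -> Pi u = 1) ->
  (forall u, 1 < u ->
     ex_RInt (fun t => Pi t * rho (u - t)) 0 u /\
     Pi u = / u * RInt (fun t => Pi t * rho (u - t)) 0 u) ->
  forall u, 0 <= u -> is_RInt (fun t => Pi t * rho (u - t)) 0 u (u * Pi u).
Proof.
move=> r1 P1 Pr u u0; case: (Rle_dec u 1) => u1.
  apply: (is_RInt_ext (fun=> 1)).
    by move=> t; rewrite Rmin_left ?Rmax_right // => ht; rewrite P1 ?r1; lra.
  have -> : u * Pi u = scal (u - 0) 1.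
    by rewrite P1 // /scal /= /mult /=; ring.
  exact: is_RInt_const.
have [ex e] := Pr u ltac:(lra); rewrite e.
have -> : u * (/ u * RInt (fun t => Pi t * rho (u - t)) 0 u) =
   RInt (fun t => Pi t * rho (u - t)) 0 u by field; lra.
exact: RInt_correct.
Qed.

Lemma Rabs_bounded_of_ex_RInt (g : R -> R) (a b : R) : a <= b -> ex_RInt g a b ->
  exists M, forall t, a <= t <= b -> Rabs (g t) <= M.
Proof.
move=> ab /ex_RInt_ub[M HM]; exists M => t ht.
by apply: HM; rewrite Rmin_left ?Rmax_right.
Qed.

(* On the window [u - 1, u] the factor rho (u - t) is 1, so integrability of the
   product there already bounds Pi. *)
Lemma convolution_bounded (rho Pi : R -> R) :
  (forall u, 0 <= u <= 1 -> rho u = 1) -> (forall u, 0 <= u <= 1 -> Pi u = 1) ->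
  (forall u, 0 <= u -> is_RInt (fun t => Pi t * rho (u - t)) 0 u (u * Pi u)) ->
  forall U, exists2 P, 1 <= P & forall t, 0 <= t <= U -> Rabs (Pi t) <= P.
Proof.
move=> r1 P1 PI U.
suff H : forall n, exists2 P, 1 <= P & forall t, 0 <= t <= INR n + 1 -> Rabs (Pi t) <= P.
  have [n hn] : exists n, U <= INR n.
    case: (Rle_dec U 0) => U0; first by exists 0%N; rewrite INR_0.
    exists (floor_nat U).+1; rewrite S_INR; have := floor_nat_bounds U; lra.
  by have [P p1 HP] := H n; exists P => // t ht; apply: HP; lra.
elim=> [|n [P p1 HP]].
  by exists 1 => [|t]; [lra|rewrite INR_0 => ht; rewrite P1 ?Rabs_R1; lra].
(* With this [u] the window [u - 1, u] is exactly the unit interval to be added. *)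
have n0 := pos_INR n; pose u := INR n + 2.
have ex : ex_RInt (fun t => Pi t * rho (u - t)) 0 u.
  by exists (u * Pi u); apply: PI; rewrite /u; lra.
have ex1 : ex_RInt (fun t => Pi t * rho (u - t)) (u - 1) u.
  by apply: ex_RInt_Chasles_2 ex; rewrite /u; lra.
have [M HM] := Rabs_bounded_of_ex_RInt _ (u - 1) u ltac:(lra) ex1.
exists (Rmax P M); first exact: Rle_trans p1 (Rmax_l _ _).
move=> t [t0]; rewrite S_INR => tn; case: (Rle_dec t (INR n + 1)) => h.
  by apply: Rle_trans (Rmax_l _ _); apply: HP.
apply: Rle_trans (Rmax_r _ _).
by have := HM t; rewrite r1 /u ?Rmult_1_r; [apply; lra|lra].
Qed.

(** First u Pi(u) is shown Lipschitz: the change in rho(v - t) over [0, u] costs UP(v - u), and the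
    new piece [u, v] costs P(v - u). Dividing by u >= 1 adds one more P, whence [U + 2]; below 1 the
    function is constant. *)
Lemma convolution_lipschitz (rho Pi : R -> R) (U P : R) :
  (forall u, 0 <= u -> Rabs (rho u) <= 1) ->
  (forall a b, 0 <= a <= b -> Rabs (rho b - rho a) <= b - a) ->
  (forall u, 0 <= u <= 1 -> Pi u = 1) ->
  (forall u, 0 <= u -> is_RInt (fun t => Pi t * rho (u - t)) 0 u (u * Pi u)) ->
  1 <= P -> (forall t, 0 <= t <= U -> Rabs (Pi t) <= P) ->
  forall u v, 0 <= u <= v -> v <= U -> Rabs (Pi v - Pi u) <= P * (U + 2) * (v - u).
Proof.
move=> rB rL P1 PI p1 PB.
have main u v : 0 <= u <= v -> v <= U -> Rabs (v * Pi v - u * Pi u) <= P * (U + 1) * (v - u).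
  move=> [u0 uv] vU; pose g v t := Pi t * rho (v - t).
  have exv : ex_RInt (g v) 0 v by exists (v * Pi v); apply: PI; lra.
  have exu : ex_RInt (g u) 0 u by exists (u * Pi u); apply: PI; lra.
  have ex1 : ex_RInt (g v) 0 u by apply: ex_RInt_Chasles_1 exv; lra.
  have ex2 : ex_RInt (g v) u v by apply: ex_RInt_Chasles_2 exv; lra.
  have Ev : v * Pi v = RInt (g v) 0 v by symmetry; apply: is_RInt_unique; apply: PI; lra.
  have Eu : u * Pi u = RInt (g u) 0 u by symmetry; apply: is_RInt_unique; apply: PI; lra.
  have Ec : RInt (g v) 0 u + RInt (g v) u v = RInt (g v) 0 v by exact: RInt_Chasles.
  have exm : ex_RInt (fun t => g v t - g u t) 0 u by exact: (ex_RInt_minus (g v) (g u)).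
  have Em : RInt (fun t => g v t - g u t) 0 u = RInt (g v) 0 u - RInt (g u) 0 u.
    exact: (RInt_minus (g v) (g u)).
  have B1 : Rabs (RInt (fun t => g v t - g u t) 0 u) <= (u - 0) * (P * (v - u)).
    apply: abs_RInt_le_const => // t ht.
    have -> : g v t - g u t = Pi t * (rho (v - t) - rho (u - t)) by rewrite /g; ring.
    rewrite Rabs_mult; apply: Rmult_le_compat; try exact: Rabs_pos.
      by apply: PB; lra.
    by have := rL (u - t) (v - t); lra.
  have B2 : Rabs (RInt (g v) u v) <= (v - u) * (P * 1).
    apply: abs_RInt_le_const => // t ht; rewrite Rabs_mult.
    apply: Rmult_le_compat; try exact: Rabs_pos; [apply: PB|apply: rB]; lra.
  have -> : v * Pi v - u * Pi u = RInt (fun t => g v t - g u t) 0 u + RInt (g v) u v by lra.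
  apply: Rle_trans (Rabs_triang _ _) _.
  have : (u - 0) * (P * (v - u)) <= U * (P * (v - u)).
    by apply: Rmult_le_compat_r; [apply: Rmult_le_pos|]; lra.
  lra.
have main1 u v : 1 <= u <= v -> v <= U -> Rabs (Pi v - Pi u) <= P * (U + 2) * (v - u).
  move=> [u1 uv] vU; have h := main u v ltac:(lra) vU.
  have b := PB v ltac:(lra).
  have e : u * (Pi v - Pi u) = (v * Pi v - u * Pi u) - (v - u) * Pi v by ring.
  have : u * Rabs (Pi v - Pi u) <= P * (U + 1) * (v - u) + (v - u) * P.
    rewrite -[X in X * _](Rabs_pos_eq u); last lra.
    rewrite -Rabs_mult e; apply: Rle_trans (Rabs_triang _ _) _.
    rewrite Rabs_Ropp Rabs_mult (Rabs_pos_eq (v - u)); last lra.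
    apply: Rplus_le_compat => //; apply: Rmult_le_compat_l; lra.
  have := Rabs_pos (Pi v - Pi u); nra.
move=> u v [u0 uv] vU.
have pos : 0 <= P * (U + 2) by apply: Rmult_le_pos; lra.
case: (Rle_dec v 1) => v1.
  rewrite !P1 ?Rminus_diag ?Rabs_R0; try lra.
  by apply: Rmult_le_pos; lra.
case: (Rle_dec 1 u) => u1; first by apply: main1; lra.
have := main1 1 v ltac:(lra) vU; rewrite (P1 u) ?(P1 1); try lra.
have : P * (U + 2) * (v - 1) <= P * (U + 2) * (v - u) by apply: Rmult_le_compat_l; lra.
lra.
Qed.

(** * From integrals to sums against point masses *)

Lemma is_RInt_reflect (g : R -> R) (u l : R) :
  is_RInt g 0 u l -> is_RInt (fun t => g (u - t)) 0 u l.
Proof.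
move=> H.
have h : is_RInt (fun t => scal (-1) (g (-1 * t + u))) 0 u (- l).
  apply: is_RInt_comp_lin; apply: is_RInt_swap.
  have -> : -1 * 0 + u = u by ring.
  by have -> : -1 * u + u = 0 by ring.
have := is_RInt_opp _ _ _ _ h; rewrite /opp /= Ropp_involutive.
apply: is_RInt_ext => t _; rewrite /scal /= /mult /=.
have -> : -1 * t + u = u - t by ring.
ring.
Qed.

(* Riemann sums against a discrete measure: the masses [w] sit at the points [t],
   and the thresholds [k j] cut the index range into blocks of length [d]. *)
Lemma block_sum_approx (P : pred nat) (w t h : nat -> R) (g : R -> R) (k : nat -> nat)
  (J : nat) (d e Lam B : R) :
  0 <= d -> 0 <= e -> 0 <= Lam -> 0 <= B ->
  k 0%N = 1%N -> (forall j, (j < J)%N -> (k j <= k j.+1)%N) ->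
  (forall i, P i -> 0 <= w i) ->
  ~~ P 1%N ->
  (forall j i, (j < J)%N -> P i -> (k j < i <= k j.+1)%N ->
     INR j * d <= t i <= INR j.+1 * d) ->
  (forall j, (j <= J)%N ->
     Rabs (\sum_(1 <= i < (k j).+1 | P i) w i - INR j * d) <= e) ->
  ex_RInt g 0 (INR J * d) ->
  (forall s, 0 <= s <= INR J * d -> Rabs (g s) <= B) ->
  (forall s s', 0 <= s <= s' -> s' <= INR J * d -> Rabs (g s' - g s) <= Lam * (s' - s)) ->
  Rabs (\sum_(1 <= i < (k J).+1 | P i) (w i * g (t i)) - RInt g 0 (INR J * d))
  <= INR J * (2 * Lam * d ^ 2 + 2 * e * (Lam * d + B)).
Proof.
move=> d0 e0 L0 B0 k0 kinc w0 P1 tk mu ex gB gL.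
suff H : forall j, (j <= J)%N ->
  Rabs (\sum_(1 <= i < (k j).+1 | P i) (w i * g (t i)) - RInt g 0 (INR j * d))
  <= INR j * (2 * Lam * d ^ 2 + 2 * e * (Lam * d + B)) by apply: H.
elim=> [_|j IH jJ].
  (* The range at [j = 0] is the single index 1, which [P] excludes, so the sum is 0. *)
  rewrite k0 big_mkcond big_nat1 (negbTE P1) INR_0 Rmult_0_l RInt_point /zero /=.
  by rewrite Rminus_diag Rabs_R0; lra.
have {}IH := IH (ltnW jJ); have jpos := pos_INR j.
have jJ' : INR j.+1 * d <= INR J * d by apply: Rmult_le_compat_r => //; exact: le_INRb.
have m1 := mu j (ltnW jJ); have m2 := mu j.+1 jJ.
have kk : ((k j).+1 <= (k j.+1).+1)%N by rewrite ltnS kinc.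
rewrite (big_cat_nat (n := (k j).+1)) //= in m2; rewrite (big_cat_nat (n := (k j).+1)) //=.
set S0 := \sum_(1 <= i < (k j).+1 | P i) (w i * g (t i)) in IH *.
set M0 := \sum_(1 <= i < (k j).+1 | P i) w i in m1 m2 *.
set M := \sum_((k j).+1 <= i < (k j.+1).+1 | P i) w i in m2 *.
set S := \sum_((k j).+1 <= i < (k j.+1).+1 | P i) (w i * g (t i)).
rewrite S_INR in jJ' m2 *; set a := INR j * d in IH m1 m2 jJ' *.
have a0 : 0 <= a by apply: Rmult_le_pos.
have ea : (INR j + 1) * d = a + d by rewrite /a; ring.
rewrite ea in m2 jJ' *.
(* The mass of a block is a difference of two cumulative masses, each known within [e]. *)
have Md : Rabs (M - d) <= 2 * e.
  have -> : M - d = (M0 + M - (a + d)) - (M0 - a) by ring.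
  by apply: Rle_trans (Rabs_triang _ _) _; rewrite Rabs_Ropp; lra.
have ex0 : ex_RInt g 0 (a + d) by apply: ex_RInt_Chasles_1 ex; lra.
have ex1 : ex_RInt g 0 a by apply: ex_RInt_Chasles_1 ex0; lra.
have ex2 : ex_RInt g a (a + d) by apply: ex_RInt_Chasles_2 ex0; lra.
have EC : RInt g 0 a + RInt g a (a + d) = RInt g 0 (a + d) by exact: RInt_Chasles.
(* Three replacements on the block: [g (t i)] by [g a], the mass [M] by [d], and [d * g a] by the
   integral. With [M <= d + 2 * e] the errors add up to the claimed increment. *)
have E1 : Rabs (S - g a * M) <= Lam * d * M.
  rewrite /S /M -!sumZ -sumB; apply: Rle_trans (sum_abs _ _ _ _) _.
  apply: ler_sumR => i /andP[ki ik] Pi.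
  have := tk j i jJ Pi; rewrite ki -ltnS ik => /(_ isT); rewrite S_INR ea -/a => ti.
  have -> : w i * g (t i) - g a * w i = w i * (g (t i) - g a) by ring.
  rewrite Rabs_mult Rabs_pos_eq; last exact: w0.
  rewrite Rmult_comm; apply: Rmult_le_compat_r; first exact: w0.
  apply: Rle_trans (gL a (t i) ltac:(lra) ltac:(lra)) _.
  by apply: Rmult_le_compat_l; lra.
have E2 : Rabs (g a * (M - d)) <= B * (2 * e).
  by rewrite Rabs_mult; apply: Rmult_le_compat => //; try exact: Rabs_pos; apply: gB; lra.
have E3 : Rabs (RInt g a (a + d) - d * g a) <= d * (Lam * d).
  have <- : RInt (fun s => g s - g a) a (a + d) = RInt g a (a + d) - d * g a.
    have := RInt_minus g (fun=> g a) a (a + d) ex2 (ex_RInt_const _ _ _).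
    rewrite RInt_const /minus /plus /opp /scal /= /mult /= => ->; ring.
  have {2}-> : d = (a + d) - a by ring.
  apply: abs_RInt_le_const; first lra.
    by apply: (ex_RInt_minus g (fun=> g a)) => //; exact: ex_RInt_const.
  move=> s hs; apply: Rle_trans (gL a s ltac:(lra) ltac:(lra)) _.
  by apply: Rmult_le_compat_l; lra.
rewrite -EC.
have -> : S0 + S - (RInt g 0 a + RInt g a (a + d)) =
  (S0 - RInt g 0 a) + ((S - g a * M) + (g a * (M - d) - (RInt g a (a + d) - d * g a))) by ring.
apply: Rle_trans (Rabs_triang _ _) _.
have t1 := Rabs_triang (S - g a * M) (g a * (M - d) - (RInt g a (a + d) - d * g a)).
have t2 := Rabs_triang (g a * (M - d)) (- (RInt g a (a + d) - d * g a)).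
rewrite Rabs_Ropp -/(Rminus _ _) in t2.
have Mle : M <= d + 2 * e by move: Md; unfold Rabs; case: Rcase_abs => ?; lra.
have : Lam * d * M <= Lam * d * (d + 2 * e).
  by apply: Rmult_le_compat_l => //; apply: Rmult_le_pos.
lra.
Qed.

(** * Sums over primes on the logarithmic scale *)

Definition logscale (L : R) (p : nat) : R := ln (INR p) / L.
Definition logweight (L : R) (p : nat) : R := ln (INR p) / (INR p * L).
(** With [L] = ln x, [exp (t * L)] is x^t, so this is the mean written [S] in the overview. *)
Definition norm_mean (L : R) (f : nat -> R) (t : R) : R :=
  (\sum_(1 <= n < (floor_nat (exp (t * L))).+1) f n) / exp (t * L).

Lemma logweight_ge0 (L : R) (p : nat) : 0 < L -> prime p -> 0 <= logweight L p.
Proof.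
move=> L0 pp; have p2 := INR_prime_ge2 p pp.
by apply: Rdiv_le_0_compat; [apply: ln_INR_ge0; exact: prime_gt0|apply: Rmult_lt_0_compat; lra].
Qed.

Lemma logscale_ge0 (L : R) (p : nat) : 0 < L -> prime p -> 0 <= logscale L p.
Proof. by move=> L0 pp; apply: Rdiv_le_0_compat => //; apply: ln_INR_ge0; exact: prime_gt0. Qed.

(** The dictionary between summation cutoffs and positions on the logarithmic scale. *)
Lemma leq_floor_exp (L a : R) (i : nat) : 0 < L -> (0 < i)%N ->
  (i <= floor_nat (exp (a * L)))%N <-> logscale L i <= a.
Proof.
move=> L0 i0; have i1 := INR_gt0 i i0; have e0 := exp_pos (a * L).
have E : logscale L i <= a <-> INR i <= exp (a * L).
  rewrite /logscale Rle_div_l //; split=> h.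
    by rewrite -(exp_ln (INR i)); [case: h => [/exp_increasing|->]; lra|lra].
  by rewrite -(ln_exp (a * L)); apply: ln_le; lra.
rewrite E; apply: leq_floor_nat; lra.
Qed.

Lemma floor_exp_gt0 (L a : R) : 0 < L -> 0 <= a -> (0 < floor_nat (exp (a * L)))%N.
Proof.
by move=> L0 a0; apply/(leq_floor_exp L a 1) => //; rewrite /logscale INR_1 ln_1; lra.
Qed.

Lemma floor_exp_le (L a b : R) : 0 < L -> 0 <= a <= b ->
  (floor_nat (exp (a * L)) <= floor_nat (exp (b * L)))%N.
Proof.
move=> L0 [a0 ab]; have k0 := floor_exp_gt0 L a L0 a0.
apply/(leq_floor_exp L b) => //; apply: Rle_trans ab.
exact/(leq_floor_exp L a).
Qed.

Lemma exp_sub_logscale (L u : R) (p : nat) : 0 < L -> (0 < p)%N ->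
  exp ((u - logscale L p) * L) = exp (u * L) / INR p.
Proof.
move=> L0 p0; have p1 := INR_gt0 p p0.
have -> : (u - logscale L p) * L = u * L + - ln (INR p) by rewrite /logscale; field; lra.
by rewrite exp_plus exp_Ropp exp_ln //; lra.
Qed.

(** Mertens contributes 4; replacing ln K by [a * L] costs at most 1 more, since K <= e^(aL) < K + 1
    with K >= 1. *)
Lemma logweight_sum (L a : R) : 0 < L -> 0 <= a ->
  Rabs (\sum_(1 <= p < (floor_nat (exp (a * L))).+1 | prime p) logweight L p - a) <= 5 / L.
Proof.
move=> L0 a0; set K := floor_nat _; have k0 : (0 < K)%N by exact: floor_exp_gt0.
have k1 := INR_gt0 K k0; have e0 := exp_pos (a * L).
have [b1 b2] := floor_nat_bounds (exp (a * L)) ltac:(lra); rewrite -/K in b1 b2.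
have -> : \sum_(1 <= p < K.+1 | prime p) logweight L p = / L * mertens_sum K.
  rewrite /mertens_sum -sumZ; apply: eq_sumR => p _ /prime_gt0/INR_gt0 p1.
  by rewrite /logweight; field; lra.
have -> : / L * mertens_sum K - a = / L * (mertens_sum K - a * L) by field; lra.
rewrite Rabs_mult Rabs_pos_eq; last by left; exact: Rinv_0_lt_compat.
rewrite Rmult_comm; apply: Rmult_le_compat_r; first by left; exact: Rinv_0_lt_compat.
have -> : mertens_sum K - a * L = (mertens_sum K - ln (INR K)) + (ln (INR K) - a * L) by ring.
apply: Rle_trans (Rabs_triang _ _) _.
suff : Rabs (ln (INR K) - a * L) <= 1 by have := mertens K k0; lra.
have l1 : ln (INR K) <= a * L by rewrite -(ln_exp (a * L)); apply: ln_le; lra.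
have l2 : a * L - ln (INR K) <= 1.
  rewrite -(ln_exp (a * L)); apply: Rle_trans (ln_sub_le (INR K) (exp (a * L)) _ e0) _; first lra.
  by apply/Rle_div_l; lra.
by apply: Rabs_le; lra.
Qed.

(** This is [log_mean_recursion] at [N] = e^(uL), divided by [N * L]. *)
Lemma norm_mean_recursion (L u : R) (c f : nat -> R) : 0 < L -> 0 <= u ->
  (forall q m, prime q -> (0 < m)%N -> f (q * m)%N = c q * f m) ->
  (forall p, prime p -> Rabs (c p) <= 1) ->
  (forall n, (0 < n)%N -> Rabs (f n) <= 1) ->
  Rabs (u * norm_mean L f u -
    \sum_(1 <= p < (floor_nat (exp (u * L))).+1 | prime p)
       (logweight L p * c p * norm_mean L f (u - logscale L p))) <= 3 / L.
Proof.
move=> L0 u0 fM c1 f1; rewrite {1}/norm_mean; set N := exp (u * L).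
have N0 : 0 < N by exact: exp_pos.
set K := floor_nat N; have k0 : (0 < K)%N by exact: floor_exp_gt0.
have [KN _] := floor_nat_bounds N ltac:(lra).
have := log_mean_recursion c f N K fM c1 f1 k0 KN.
rewrite {1}/N ln_exp => h.
set F := \sum_(1 <= n < K.+1) f n in h *.
set T := \sum_(1 <= p < K.+1 | prime p) _ in h.
have -> : \sum_(1 <= p < K.+1 | prime p)
   (logweight L p * c p * norm_mean L f (u - logscale L p)) = / (N * L) * T.
  rewrite /T -sumZ; apply: eq_sumR => p _ pp; have p1 := INR_gt0 p (prime_gt0 pp).
  rewrite /norm_mean exp_sub_logscale ?prime_gt0 // -/N floor_nat_div ?prime_gt0 //; last lra.
  by rewrite /logweight -/K; field; lra.
have -> : u * (F / N) - / (N * L) * T = / (N * L) * (u * L * F - T) by field; lra.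
have i0 : 0 < / (N * L) by apply: Rinv_0_lt_compat; apply: Rmult_lt_0_compat.
rewrite Rabs_mult Rabs_pos_eq; last lra.
have -> : 3 / L = / (N * L) * (3 * N) by field; lra.
by apply: Rmult_le_compat_l => //; lra.
Qed.

(** The exponential equals p/N with N = e^(uL), so each term is ln p/(NL) and Chebyshev's bound
    applies. This controls the part x^-t of the error when it is fed back into the recursion. *)
Lemma logweight_exp_sum (L u : R) : 0 < L -> 0 <= u ->
  \sum_(1 <= p < (floor_nat (exp (u * L))).+1 | prime p)
    (logweight L p * exp (- (u - logscale L p) * L)) <= 4 / L.
Proof.
move=> L0 u0; set N := exp (u * L); set K := floor_nat N.
have N0 : 0 < N by exact: exp_pos.
have -> : \sum_(1 <= p < K.+1 | prime p) (logweight L p * exp (- (u - logscale L p) * L))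
  = / (N * L) * theta K.
  rewrite /theta -sumZ; apply: eq_sumR => p _ pp; have p1 := INR_gt0 p (prime_gt0 pp).
  rewrite -Ropp_mult_distr_l exp_Ropp exp_sub_logscale ?prime_gt0 // -/N /logweight.
  by field; lra.
have [KN _] := floor_nat_bounds N ltac:(lra).
have -> : 4 / L = / (N * L) * (4 * N) by field; lra.
apply: Rmult_le_compat_l; last by have := theta_le K; rewrite -/K in KN; lra.
by left; apply: Rinv_0_lt_compat; apply: Rmult_lt_0_compat.
Qed.

(* With this kappa the sums below act as a contraction by 1/2 in the norm
   sup |E(t)| exp (- kappa t). *)
Definition kappa (U : R) : R := 8 * ln (4 * (U + 1)).

Lemma kappa_ge0 (U : R) : 0 <= U -> 0 <= kappa U.
Proof.
move=> U0; apply: Rmult_le_pos; first lra.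
by rewrite -ln_1; apply: ln_le; lra.
Qed.

(** Cut at 1/8. The near part has mass at most 1/8 + 5/L <= 1/4. On the far part the exponential is
    at most 1/(4(U + 1)) by the choice of [kappa], against a mass of at most U + 1. *)
Lemma logweight_kappa_sum (L u U : R) : 40 <= L -> 0 <= u <= U ->
  \sum_(1 <= p < (floor_nat (exp (u * L))).+1 | prime p)
    (logweight L p * exp (- kappa U * logscale L p)) <= / 2.
Proof.
move=> L40 [u0 uU]; have L0 : 0 < L by lra.
have k0 := kappa_ge0 U ltac:(lra).
have e5 : 5 / L <= / 8 by apply/Rle_div_l; lra.
have le1 a b : \sum_(a <= p < b | prime p) (logweight L p * exp (- kappa U * logscale L p))
    <= \sum_(a <= p < b | prime p) logweight L p.
  apply: ler_sumR => p _ pp; rewrite -[X in _ <= X]Rmult_1_r.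
  apply: Rmult_le_compat_l; first exact: logweight_ge0.
  rewrite -exp_0; case: (Rle_lt_or_eq_dec (- kappa U * logscale L p) 0) => [|h|->]; last lra.
    have := logscale_ge0 L p L0 pp; nra.
  by left; exact: exp_increasing.
have mu a : 0 <= a ->
    \sum_(1 <= p < (floor_nat (exp (a * L))).+1 | prime p) logweight L p <= a + / 8.
  move=> a0; have := logweight_sum L a L0 a0; unfold Rabs; case: Rcase_abs => ?; lra.
case: (Rle_dec u (/ 8)) => u8.
  by apply: Rle_trans (le1 _ _) _; have := mu u u0; lra.
set K := floor_nat (exp (u * L)); pose K1 := floor_nat (exp (/ 8 * L)).
have KK : (K1.+1 <= K.+1)%N by rewrite ltnS; apply: floor_exp_le; lra.
have K1p : (1 <= K1.+1)%N by [].
rewrite (big_cat_nat K1p KK) /=.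
have A1 := Rle_trans _ _ _ (le1 1%N K1.+1) (mu (/ 8) ltac:(lra)).
suff : \sum_(K1.+1 <= p < K.+1 | prime p) (logweight L p * exp (- kappa U * logscale L p)) <= / 4 by lra.
apply: Rle_trans (_ : / (4 * (U + 1)) * \sum_(K1.+1 <= p < K.+1 | prime p) logweight L p <= _).
  rewrite -sumZ; apply: ler_sumR => p /andP[kp _] pp.
  rewrite Rmult_comm; apply: Rmult_le_compat_r; first exact: logweight_ge0.
  have t8 : / 8 < logscale L p.
    apply: Rnot_le_lt => /(leq_floor_exp L (/ 8) p L0 (prime_gt0 pp)).
    by rewrite -/K1 leqNgt kp.
  have -> : / (4 * (U + 1)) = exp (- kappa U * / 8).
    have -> : - kappa U * / 8 = - ln (4 * (U + 1)) by rewrite /kappa; field.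
    by rewrite exp_Ropp exp_ln //; lra.
  case: (Rle_lt_or_eq_dec (- kappa U * logscale L p) (- kappa U * / 8)) => [|h|->]; last lra.
    nra.
  by left; exact: exp_increasing.
have A2 := mu u u0; rewrite -/K (big_cat_nat K1p KK) /= in A2.
have A3 : 0 <= \sum_(1 <= p < K1.+1 | prime p) logweight L p.
  by apply: sum_ge0 => p _ pp; exact: logweight_ge0.
have -> : / 4 = / (4 * (U + 1)) * (U + 1) by field; lra.
apply: Rmult_le_compat_l; last lra.
by left; apply: Rinv_0_lt_compat; lra.
Qed.

(** * The limit function nearly satisfies the discrete recursion *)

(** Apply [block_sum_approx] with [J] blocks of length u/J and mass error 5/L. The integrand rho(s)
    Pi(u - s) is bounded by [P] and has Lipschitz constant P + P(U + 2) = P(U + 3). *)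
Lemma prime_sum_approx (rho Pi : R -> R) (L u U P : R) (J : nat) :
  0 < L -> 0 <= u <= U -> (0 < J)%N ->
  (forall t, 0 <= t -> Rabs (rho t) <= 1) ->
  (forall a b, 0 <= a <= b -> Rabs (rho b - rho a) <= b - a) ->
  (forall t, 0 <= t <= U -> Rabs (Pi t) <= P) -> 1 <= P ->
  (forall a b, 0 <= a <= b -> b <= U -> Rabs (Pi b - Pi a) <= P * (U + 2) * (b - a)) ->
  is_RInt (fun t => Pi t * rho (u - t)) 0 u (u * Pi u) ->
  Rabs (\sum_(1 <= p < (floor_nat (exp (u * L))).+1 | prime p)
     (logweight L p * rho (logscale L p) * Pi (u - logscale L p)) - u * Pi u)
  <= 2 * (P * (U + 3)) * U ^ 2 / INR J + 10 / L * (P * (U + 3) * U + INR J * P).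
Proof.
move=> L0 [u0 uU] J0 rB rL PB p1 PL PI.
(* The unsimplified argument of [rho] is the form that [is_RInt_reflect] produces. *)
pose g s := Pi (u - s) * rho (u - (u - s)).
have gI : is_RInt g 0 u (u * Pi u) by exact: (is_RInt_reflect (fun t => Pi t * rho (u - t))).
have gE s : g s = rho s * Pi (u - s).
  have e : u - (u - s) = s by ring.
  by rewrite /g e Rmult_comm.
have J1 := INR_gt0 J J0; pose d := u / INR J.
have d0 : 0 <= d by apply: Rdiv_le_0_compat; lra.
have Jd : INR J * d = u by rewrite /d; field; lra.
pose Lam := P * (U + 3).
have Lam0 : 0 <= Lam by apply: Rmult_le_pos; lra.
have e0 : 0 <= 5 / L by apply: Rdiv_le_0_compat; lra.
have jd j : (j <= J)%N -> 0 <= INR j * d <= u.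
  move=> jJ; split; first by apply: Rmult_le_pos => //; exact: pos_INR.
  by rewrite -Jd; apply: Rmult_le_compat_r => //; exact: le_INRb.
pose k j := floor_nat (exp (INR j * d * L)).
have := block_sum_approx prime (logweight L) (logscale L) (fun=> 0) g k J d (5 / L) Lam P
  d0 e0 Lam0 ltac:(lra).
have kJ : k J = floor_nat (exp (u * L)) by rewrite /k Jd.
rewrite Jd (is_RInt_unique _ _ _ _ gI) kJ => H.
rewrite (eq_sumR _ _ _ _ (fun p => logweight L p * g (logscale L p))); last first.
  by move=> p _ _; rewrite gE Rmult_assoc.
apply: Rle_trans (H _ _ _ _ _ _ _ _ _) _.
- apply/eqP; rewrite eqn_leq; apply/andP; split; last by apply: floor_exp_gt0; rewrite ?INR_0; lra.
  rewrite -ltnS; apply/ltP/INR_lt.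
  have [h _] := floor_nat_bounds (exp (INR 0 * d * L)) (Rlt_le _ _ (exp_pos _)).
  apply: Rle_lt_trans h _; rewrite INR_0 !Rmult_0_l exp_0 !S_INR INR_0; lra.
- move=> j jJ; apply: floor_exp_le => //; split; first by have := jd j (ltnW jJ); lra.
  by apply: Rmult_le_compat_r => //; exact: le_INRb.
- by move=> p pp; exact: logweight_ge0.
- by [].
- move=> j i jJ pi /andP[ki ik]; have i0 := prime_gt0 pi; split.
    apply: Rnot_lt_le => h; move: ki; rewrite ltnNge => /negP; apply.
    by apply/leq_floor_exp => //; lra.
  by apply/leq_floor_exp.
- by move=> j jJ; apply: logweight_sum => //; have := jd j jJ; lra.
- by exists (u * Pi u).
- move=> s hs; rewrite gE Rabs_mult -[X in _ <= X]Rmult_1_l.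
  by apply: Rmult_le_compat; try exact: Rabs_pos; [apply: rB|apply: PB]; lra.
- move=> s s' ss su; rewrite !gE.
  have -> : rho s' * Pi (u - s') - rho s * Pi (u - s) =
    (rho s' - rho s) * Pi (u - s') + - (rho s * (Pi (u - s) - Pi (u - s'))) by ring.
  apply: Rle_trans (Rabs_triang _ _) _; rewrite Rabs_Ropp !Rabs_mult.
  have -> : Lam * (s' - s) = (s' - s) * P + 1 * (P * (U + 2) * (s' - s)) by rewrite /Lam; ring.
  apply: Rplus_le_compat; apply: Rmult_le_compat; try exact: Rabs_pos.
  + exact: rL.
  + by apply: PB; lra.
  + by apply: rB; lra.
  + by have := PL (u - s') (u - s) ltac:(lra) ltac:(lra); have -> : u - s - (u - s') = s' - s by ring.
have -> : INR J * (2 * Lam * d ^ 2 + 2 * (5 / L) * (Lam * d + P)) =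
  2 * Lam * u ^ 2 / INR J + 10 / L * (Lam * u + INR J * P) by rewrite /d; field; lra.
rewrite -/Lam; apply: Rplus_le_compat.
  apply: Rmult_le_compat_r; first by left; apply: Rinv_0_lt_compat; lra.
  by apply: Rmult_le_compat_l; [lra|apply: pow_incr; lra].
apply: Rmult_le_compat_l; first by apply: Rdiv_le_0_compat; lra.
by apply: Rplus_le_compat_r; apply: Rmult_le_compat_l.
Qed.

(** * Contraction and passage to the limit *)

(** The margin 7/L in the hypothesis pays for 3/L from [norm_mean_recursion] and 4/L from
    [logweight_exp_sum]. *)
Lemma norm_mean_stability (L U delta : R) (rho Pi : R -> R) (f : nat -> R) :
  40 <= L -> 0 <= delta ->
  (forall q m, prime q -> (0 < m)%N -> f (q * m)%N = rho (logscale L q) * f m) ->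
  (forall t, 0 <= t -> Rabs (rho t) <= 1) ->
  (forall n, (0 < n)%N -> Rabs (f n) <= 1) ->
  (forall n, (0 < n)%N -> logscale L n <= 1 -> f n = 1) ->
  (forall t, 0 <= t <= 1 -> Pi t = 1) ->
  (forall t, 1 <= t <= U ->
    Rabs (\sum_(1 <= p < (floor_nat (exp (t * L))).+1 | prime p)
     (logweight L p * rho (logscale L p) * Pi (t - logscale L p)) - t * Pi t) <= delta - 7 / L) ->
  forall t, 0 <= t <= U ->
  Rabs (norm_mean L f t - Pi t) <= exp (- t * L) + 2 * delta * exp (kappa U * t).
Proof.
move=> L40 d0 fM rB fB f1 P1 HD; have L0 : 0 < L by lra.
(* Induction on the integer cutoff: passing from t to t minus [logscale L p] divides it by p >= 2,
   so it strictly decreases. *)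
suff H : forall n t, (floor_nat (exp (t * L)) <= n)%N -> 0 <= t <= U ->
  Rabs (norm_mean L f t - Pi t) <= exp (- t * L) + 2 * delta * exp (kappa U * t).
  by move=> t; apply: (H _ t (leqnn _)).
elim=> [|n IH] t; first by move=> h [t0 _]; move: (floor_exp_gt0 L t L0 t0); rewrite ltnNge h.
set K := floor_nat (exp (t * L)) => Kn [t0 tU].
have N0 := exp_pos (t * L).
have [b1 b2] := floor_nat_bounds (exp (t * L)) ltac:(lra); rewrite -/K in b1 b2.
have k0 := kappa_ge0 U ltac:(lra); have ek := exp_pos (kappa U * t).
(* Up to 1 all summands are 1, and the only error is the rounding of the cutoff, at most 1 before
   division by e^(tL). *)
case: (Rle_dec t 1) => t1.
  rewrite /norm_mean -/K (eq_sumR _ _ _ _ (fun=> 1)); last first.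
    move=> m /andP[m0 mK] _; apply: f1 => //; apply: Rle_trans t1.
    by apply/leq_floor_exp.
  rewrite sum1_INR P1; last lra.
  rewrite -Ropp_mult_distr_l exp_Ropp.
  have -> : INR K / exp (t * L) - 1 = / exp (t * L) * (INR K - exp (t * L)) by field; lra.
  have i0 : 0 < / exp (t * L) by exact: Rinv_0_lt_compat.
  rewrite Rabs_mult Rabs_pos_eq; last lra.
  have : / exp (t * L) * Rabs (INR K - exp (t * L)) <= / exp (t * L) * 1.
    by apply: Rmult_le_compat_l; [lra|apply: Rabs_le; lra].
  have : 0 <= 2 * delta * exp (kappa U * t) by apply: Rmult_le_pos; lra.
  lra.
have c1 p : prime p -> Rabs (rho (logscale L p)) <= 1.
  by move=> pp; apply: rB; exact: logscale_ge0.
have R1 := norm_mean_recursion L t (fun p => rho (logscale L p)) f L0 t0 fM c1 fB.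
have R2 := HD t ltac:(lra).
set S1 := \sum_(1 <= p < K.+1 | prime p) _ in R1; set S2 := \sum_(1 <= p < K.+1 | prime p) _ in R2.
have R3 : Rabs (S1 - S2) <= 4 / L + 2 * delta * exp (kappa U * t) * / 2.
  rewrite /S1 /S2 -sumB; apply: Rle_trans (sum_abs _ _ _ _) _.
  apply: Rle_trans (Rplus_le_compat _ _ _ _ (logweight_exp_sum L t L0 t0)
    (Rmult_le_compat_l _ _ _ _ (logweight_kappa_sum L t U L40 (conj t0 tU)))); last first.
    by apply: Rmult_le_pos; lra.
  rewrite -sumZ -sumD; apply: ler_sumR => p /andP[p1 pK] pp.
  have w0 := logweight_ge0 L p L0 pp; have p0 := prime_gt0 pp.
  have tp : logscale L p <= t by apply/leq_floor_exp.
  have tp0 := logscale_ge0 L p L0 pp.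
  have h : Rabs (norm_mean L f (t - logscale L p) - Pi (t - logscale L p)) <=
      exp (- (t - logscale L p) * L) + 2 * delta * exp (kappa U * (t - logscale L p)).
    apply: IH; last lra.
    rewrite exp_sub_logscale // floor_nat_div //; last lra.
    by rewrite -ltnS (leq_trans _ Kn) // ltn_Pdiv ?prime_gt1 // -/K (leq_trans p0).
  have -> : logweight L p * rho (logscale L p) * norm_mean L f (t - logscale L p) -
     logweight L p * rho (logscale L p) * Pi (t - logscale L p) =
     logweight L p * (rho (logscale L p) * (norm_mean L f (t - logscale L p) - Pi (t - logscale L p))) by ring.
  rewrite Rabs_mult (Rabs_pos_eq (logweight L p)) //.
  have -> : logweight L p * exp (- (t - logscale L p) * L) +
    2 * delta * exp (kappa U * t) * (logweight L p * exp (- kappa U * logscale L p)) =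
    logweight L p * (exp (- (t - logscale L p) * L) + 2 * delta * exp (kappa U * (t - logscale L p))).
    have -> : kappa U * (t - logscale L p) = kappa U * t + - kappa U * logscale L p by ring.
    rewrite exp_plus; ring.
  apply: Rmult_le_compat_l => //; apply: Rle_trans h.
  rewrite Rabs_mult; have := c1 p pp; have := Rabs_pos (norm_mean L f (t - logscale L p) - Pi (t - logscale L p)); nra.
(* The contraction has halved the exponential term. As the exponential is at least 1 and t > 1,
   dividing by [t] restores the factor [2 * delta]. *)
have R : t * Rabs (norm_mean L f t - Pi t) <= delta + delta * exp (kappa U * t).
  rewrite -[X in X * _](Rabs_pos_eq t) // -Rabs_mult.
  have -> : t * (norm_mean L f t - Pi t) = (t * norm_mean L f t - S1) + ((S1 - S2) + (S2 - t * Pi t)) by ring.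
  apply: Rle_trans (Rabs_triang _ _) _.
  have := Rabs_triang (S1 - S2) (S2 - t * Pi t).
  have : 3 / L + 4 / L = 7 / L by field; lra.
  lra.
have e1 : 1 <= exp (kappa U * t).
  have : 0 <= kappa U * t by apply: Rmult_le_pos; lra.
  by move=> h; have := exp_ineq1_le (kappa U * t); lra.
have := exp_pos (- t * L); have := Rabs_pos (norm_mean L f t - Pi t); nra.
Qed.

Theorem mainTheorem4 (rho Pi : R -> R)
  (* rho is the Dickman function *)
  (Hrho_cont : forall u, 0 <= u ->
     filterlim rho (within (fun t => 0 <= t) (locally u)) (locally (rho u)))
  (Hrho_1 : forall u, 0 <= u <= 1 -> rho u = 1)
  (Hrho_de : forall u, 1 < u ->
     ex_derive rho u /\ u * Derive rho u + rho (u - 1) = 0)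
  (* Pi is defined by its integral equation *)
  (HPi_1 : forall u, 0 <= u <= 1 -> Pi u = 1)
  (HPi_rec : forall u, 1 < u ->
     ex_RInt (fun t => Pi t * rho (u - t)) 0 u /\
     Pi u = / u * RInt (fun t => Pi t * rho (u - t)) 0 u) :
  forall u, 0 < u ->
    is_lim (fun x => / Rpower x u * sum_upto (f_x rho x) (Rpower x u))
           p_infty (Finite (Pi u)).
Proof.
move=> U U0.
have rB := dickman_bounded _ Hrho_cont Hrho_1 Hrho_de.
have rL := dickman_lipschitz _ Hrho_cont Hrho_1 Hrho_de.
have PI := convolution_is_RInt _ _ Hrho_1 HPi_1 HPi_rec.
have [P p1 PB] := convolution_bounded _ _ Hrho_1 HPi_1 PI U.
have PL := convolution_lipschitz _ _ U P rB rL HPi_1 PI p1 PB.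
apply/is_lim_spec => eps.
have e0 := cond_pos eps; have E0 := exp_pos (kappa U * U).
(* Makes the stability error [2 * delta * exp (kappa U * U)] equal to eps/4. *)
pose delta := eps / (8 * exp (kappa U * U)).
have d0 : 0 < delta by apply: Rdiv_lt_0_compat; lra.
pose Lam := P * (U + 3).
have Lam0 : 0 < Lam by apply: Rmult_lt_0_compat; lra.
pose A := 2 * Lam * U ^ 2.
have A0 : 0 <= A by apply: Rmult_le_pos; [lra|exact: pow2_ge_0].
(* The number of blocks is fixed before [L], because the Mertens error grows with [J] and is then
   made small by [L]. *)
pose J := (floor_nat (2 * A / delta)).+1.
have JA : A / INR J <= delta / 2.
  have q0 : 0 <= 2 * A / delta by apply: Rdiv_le_0_compat; lra.
  have [_ h] := floor_nat_bounds _ q0; rewrite -S_INR -/J in h.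
  have J1 : 1 <= INR J by exact: INR_gt0.
  apply/Rle_div_l; first lra.
  have : 2 * A / delta * delta <= INR J * delta by apply: Rmult_le_compat_r; lra.
  have -> : 2 * A / delta * delta = 2 * A by field; lra.
  lra.
pose C := 7 + 10 * (Lam * U + INR J * P).
have C0 : 0 < C.
  have : 0 <= INR J * P by apply: Rmult_le_pos; [exact: pos_INR|lra].
  have : 0 <= Lam * U by apply: Rmult_le_pos; lra.
  rewrite /C; lra.
(* The three terms give, in order, the threshold of the contraction, C/L <= delta/2, and e^(-UL) <
   eps/2. *)
pose L0 := 40 + 2 * C / delta + 2 / (U * eps).
have q1 : 0 < 2 * C / delta by apply: Rdiv_lt_0_compat; lra.
have q2 : 0 < 2 / (U * eps) by apply: Rdiv_lt_0_compat; [lra|apply: Rmult_lt_0_compat].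
exists (exp L0) => x hx.
have x0 : 0 < x by have := exp_pos L0; lra.
have hL : L0 < ln x by rewrite -(ln_exp L0); apply: ln_increasing => //; exact: exp_pos.
set L := ln x in hL; have L40 : 40 <= L by rewrite /L0 in hL; lra.
have CL : C / L <= delta / 2.
  apply/Rle_div_l; first lra.
  have : 2 * C / delta * delta <= L * delta by apply: Rmult_le_compat_r; rewrite /L0 in hL; lra.
  have -> : 2 * C / delta * delta = 2 * C by field; lra.
  lra.
have -> : / Rpower x U * sum_upto (f_x rho x) (Rpower x U) = norm_mean L (f_x rho x) U.
  by rewrite sum_uptoE /norm_mean Rmult_comm.
have rx p : prime p -> Rabs (rho (logscale L p)) <= 1.
  by move=> pp; apply: rB; apply: logscale_ge0 => //; lra.
have := norm_mean_stability L U delta rho Pi (f_x rho x) L40 (Rlt_le _ _ d0).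
move=> H; apply: Rle_lt_trans (H _ rB _ _ HPi_1 _ U _) _.
- by move=> q m pq m0; rewrite f_x_mul.
- by move=> n n0; apply: f_x_abs_le1.
- move=> n n0 n1; apply: f_x_eq1 => // p pp pn; apply: Hrho_1; split.
    by apply: (logscale_ge0 L) => //; lra.
  apply: Rle_trans n1; rewrite -/L /logscale; apply: Rmult_le_compat_r; first by left; apply: Rinv_0_lt_compat; lra.
  apply: ln_le; [have := INR_gt0 p (prime_gt0 pp); lra|exact: le_INRb].
- move=> t [t1 tU].
  apply: Rle_trans (prime_sum_approx rho Pi L t U P J _ _ _ rB rL PB p1 PL (PI t _)) _ => //; try lra.
  (* [C] includes the 7 so that the two halves of [delta] leave exactly the required margin. *)
  have : C / L = 7 / L + 10 / L * (Lam * U + INR J * P) by rewrite /C; field; lra.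
  rewrite -/Lam -/A; lra.
- lra.
have -> : 2 * delta * exp (kappa U * U) = eps / 4 by rewrite /delta; field; lra.
suff : exp (- U * L) < eps / 2 by lra.
have UL : 0 < U * L by apply: Rmult_lt_0_compat; lra.
rewrite -Ropp_mult_distr_l exp_Ropp.
(* The crude bound e^y >= y suffices for the decay. *)
apply: Rle_lt_trans (_ : / (U * L) < _).
  by apply: Rinv_le_contravar => //; have := exp_ineq1_le (U * L); lra.
have h : 2 < U * L * eps.
  have : 2 / (U * eps) * (U * eps) < L * (U * eps).
    by apply: Rmult_lt_compat_r; [exact: Rmult_lt_0_compat|rewrite /L0 in hL; lra].
  have -> : 2 / (U * eps) * (U * eps) = 2 by field; lra.
  lra.
apply: (Rmult_lt_reg_l (U * L)) => //; rewrite Rinv_r; lra.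
Qed.
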